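(* For every $n\geq 1$, the quiver of $\mathbb C\mathfrak T_n$ is acyclic (i.e., has no directed cycles, including loops).
   Context: $\mathfrak T_n$ is the monoid of all self-maps of $[n]=\{1,\ldots,n\}$ under composition. All modules are left modules. For a finite dimensional algebra $A$ over an algebraically closed field, the quiver of $A$ is the directed graph whose vertices are the isomorphism classes of simple $A$-modules and in which the number of directed edges from the class of $S_1$ to the class of $S_2$ is $\dim\operatorname{Ext}^1_A(S_1,S_2)$. *)

(* Defs.v *)
From HB Require Import structures.
From mathcomp Require Import all_boot all_order all_algebra all_field.
From mathcomp Require Import boolp reals.
From mathcomp.real_closed Require Export complex.

Set Implicit Arguments.
Unset Strict Implicit.
Unset Printing Implicit Defensive.

Import GRing.Theory.
Local Open Scope ring_scope.

#[short(type="finMonoidType")]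
HB.structure Definition FinMonoid := {M of Finite M & Monoid M}.

(* [n] = {1, ..., n} is rendered as 'I_n = {0, ..., n - 1}. The alias keeps    *)
(* the composition product apart from any pointwise structure on {ffun _}.    *)
Definition full_transf (n : nat) : Type := {ffun 'I_n -> 'I_n}.

Section FullTransformationMonoid.
Variable n : nat.
Implicit Types f g h : full_transf n.

HB.instance Definition _ := Finite.copy (full_transf n) {ffun 'I_n -> 'I_n}.

Definition transf_comp f g : full_transf n :=
  [ffun x => (f : {ffun _ -> _}) ((g : {ffun _ -> _}) x)].

Definition transf_id : full_transf n := [ffun x => x].

Fact transf_compA : associative transf_comp.
Proof. by move=> f g h; apply/ffunP=> x; rewrite !ffunE. Qed.

Fact transf_comp1g : left_id transf_id transf_comp.
Proof. by move=> f; apply/ffunP=> x; rewrite !ffunE. Qed.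

Fact transf_compg1 : right_id transf_id transf_comp.
Proof. by move=> f; apply/ffunP=> x; rewrite !ffunE. Qed.

HB.instance Definition _ := isMonoid.Build (full_transf n)
  transf_compA transf_comp1g transf_compg1.

End FullTransformationMonoid.

(* u : monoid_algebra F M stands for the formal sum of the u(m) m, m in M; the *)
(* product is convolution, not the pointwise product of {ffun M -> F}.        *)
Definition monoid_algebra (F : fieldType) (M : finMonoidType) : Type :=
  {ffun M -> F^o}.

Section MonoidAlgebra.
Variables (F : fieldType) (M : finMonoidType).
Local Notation FM := (monoid_algebra F M).
Implicit Types u v w : FM.

HB.instance Definition _ := Vector.copy FM {ffun M -> F^o}.

Definition malg_coef u (m : M) : F := (u : {ffun M -> F^o}) m.

Definition malg_mul u v : FM :=
  [ffun m => \sum_(p : M * M | (p.1 * p.2)%g == m)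
               malg_coef u p.1 * malg_coef v p.2].

Definition malg_one : FM := [ffun m => (m == 1%g)%:R].

Lemma malg_mulE u v m : malg_coef (malg_mul u v) m =
  \sum_x \sum_(y | (x * y)%g == m) malg_coef u x * malg_coef v y.
Proof.
rewrite /malg_coef ffunE (pair_big_dep predT (fun x y => (x * y)%g == m)) /=.
exact: eq_bigl.
Qed.

Fact malg_mulA : associative malg_mul.
Proof.
move=> u v w; apply/ffunP=> m.
change (malg_coef (malg_mul u (malg_mul v w)) m
      = malg_coef (malg_mul (malg_mul u v) w) m).
transitivity (\sum_x \sum_y \sum_(z | (x * (y * z))%g == m)
   malg_coef u x * (malg_coef v y * malg_coef w z)).
  rewrite malg_mulE; apply: eq_bigr => x _.
  under eq_bigr => t _ do rewrite malg_mulE mulr_sumr.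
  rewrite exchange_big /=; apply: eq_bigr => y _.
  under eq_bigr => t _ do rewrite mulr_sumr.
  rewrite (exchange_big_dep predT) //= [RHS]big_mkcond /=.
  apply: eq_bigr => z _.
  case: ifP => [/eqP xyz|xyz].
    rewrite (big_pred1 (y * z)%g) // => t /=.
    by rewrite [(y * z)%g == t]eq_sym andb_idl // => /eqP->; apply/eqP.
  rewrite big_pred0 // => t; apply/negP=> /andP[/eqP xt /eqP yzt].
  by rewrite yzt xt eqxx in xyz.
rewrite malg_mulE.
under [RHS]eq_bigr => t _.
  under eq_bigr => z _ do rewrite malg_mulE mulr_suml.
  over.
rewrite /=.
under [RHS]eq_bigr => t _ do rewrite exchange_big /=.
rewrite [RHS]exchange_big /=; apply: eq_bigr => x _.
under [RHS]eq_bigr => t _.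
  under eq_bigr => z _ do rewrite mulr_suml.
  rewrite (exchange_big_dep predT) //=.
  over.
rewrite /= exchange_big /=; apply: eq_bigr => y _.
rewrite (exchange_big_dep predT) //= big_mkcond /=; apply: eq_bigr => z _.
case: ifP => [/eqP xyz|xyz].
  rewrite (big_pred1 (x * y)%g) => [|t /=]; first by rewrite mulrA.
  rewrite [(x * y)%g == t]eq_sym andb_idl // => /eqP->.
  by rewrite -mulgA; apply/eqP.
rewrite big_pred0 // => t; apply/negP=> /andP[/eqP tz /eqP xyt].
by rewrite mulgA xyt tz eqxx in xyz.
Qed.

Fact malg_mul1l : left_id malg_one malg_mul.
Proof.
move=> u; apply/ffunP=> m; change (malg_coef (malg_mul malg_one u) m = u m).
rewrite malg_mulE (bigD1 1%g) //= [X in _ + X]big1 ?addr0 => [|x x1].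
  rewrite (big_pred1 m) => [|y]; last by rewrite /= mul1g.
  by rewrite /malg_coef ffunE eqxx mul1r.
by rewrite big1 // => y _; rewrite /malg_coef ffunE (negPf x1) mul0r.
Qed.

Fact malg_mul1r : right_id malg_one malg_mul.
Proof.
move=> u; apply/ffunP=> m; change (malg_coef (malg_mul u malg_one) m = u m).
rewrite malg_mulE (exchange_big_dep predT) //= (bigD1 1%g) //=.
rewrite [X in _ + X]big1 ?addr0 => [|x x1].
  rewrite (big_pred1 m) => [|y]; last by rewrite /= mulg1.
  by rewrite /malg_coef [X in _ * X]ffunE eqxx mulr1.
by rewrite big1 // => y _; rewrite /malg_coef [X in _ * X]ffunE (negPf x1) mulr0.
Qed.

Fact malg_mulDl : left_distributive malg_mul +%R.
Proof.
move=> u v w; apply/ffunP=> m; rewrite !ffunE -big_split /=.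
by apply: eq_bigr => p _; rewrite /malg_coef ffunE mulrDl.
Qed.

Fact malg_mulDr : right_distributive malg_mul +%R.
Proof.
move=> u v w; apply/ffunP=> m; rewrite !ffunE -big_split /=.
by apply: eq_bigr => p _; rewrite /malg_coef ffunE mulrDr.
Qed.

Fact malg_one_neq0 : malg_one != 0.
Proof.
by apply/eqP=> /ffunP/(_ 1%g)/eqP; rewrite !ffunE eqxx oner_eq0.
Qed.

HB.instance Definition _ := GRing.Zmodule_isNzRing.Build FM
  malg_mulA malg_mul1l malg_mul1r malg_mulDl malg_mulDr malg_one_neq0.

Fact malg_scaleAl (c : F) (u v : FM) : c *: (u * v) = (c *: u) * v.
Proof.
apply/ffunP=> m; rewrite !ffunE scaler_sumr.
by apply: eq_bigr => p _; rewrite /malg_coef ffunE -mulrA.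
Qed.

HB.instance Definition _ := GRing.Lmodule_isLalgebra.Build F FM malg_scaleAl.

Fact malg_scaleAr (c : F) (u v : FM) : c *: (u * v) = u * (c *: v).
Proof.
apply/ffunP=> m; rewrite !ffunE scaler_sumr.
apply: eq_bigr => p _; rewrite /malg_coef ffunE mulrCA //.
Qed.

HB.instance Definition _ := GRing.Lalgebra_isAlgebra.Build F FM malg_scaleAr.
HB.instance Definition _ := Algebra_isFalgebra.Build F FM.

End MonoidAlgebra.

(* Finite dimensional left modules over an F-algebra A, presented as          *)
(* representations of A. As A is finite dimensional every simple A-module is  *)
(* finite dimensional, so this covers all the vertices of the quiver.         *)
Record fdModule (F : fieldType) (A : falgType F) := FdModule {
  fdm_sort :> vectType F;
  fdm_act : A -> 'End(fdm_sort);
  fdm_act_linear : linear fdm_act;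
  fdm_act1 : fdm_act 1 = \1%VF;
  fdm_actM : forall a b, fdm_act (a * b) = (fdm_act a \o fdm_act b)%VF
}.

Section Modules.
Variables (F : fieldType) (A : falgType F).
Implicit Types M N : fdModule A.

Definition is_submodule M (U : {vspace M}) : Prop :=
  forall a : A, (fdm_act M a @: U <= U)%VS.

Definition is_simple M : Prop :=
  fullv != 0%VS :> {vspace M} /\
  forall U : {vspace M}, is_submodule U -> U = 0%VS \/ U = fullv.

Definition commutator M N (a : A) (f : 'Hom(M, N)) : 'Hom(M, N) :=
  ((f \o fdm_act M a) - (fdm_act N a \o f))%VF.

(* Hom_A(M, N) as a subspace of Hom_F(M, N); by linearity it is enough to     *)
(* test commutation on a basis of A (see Hom_modP).                           *)
Definition Hom_mod M N : {vspace 'Hom(M, N)} :=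
  (\bigcap_(i < \dim {:A}) lker (linfun (commutator (vbasis {:A})`_i)))%VS.

Fact commutator_linear M N a : linear (@commutator M N a).
Proof.
move=> c f g; apply/lfunP=> x.
rewrite !(add_lfunE, scale_lfunE, opp_lfunE, comp_lfunE) linearP /=.
by rewrite opprD scalerBr addrACA.
Qed.

Definition commutator_lin M N a : {linear 'Hom(M, N) -> 'Hom(M, N)} :=
  HB.pack (@commutator M N a)
    (GRing.isLinear.Build _ _ _ _ _ (@commutator_linear M N a)).

Definition fdm_act_lin M : {linear A -> 'End(M)} :=
  HB.pack (fdm_act M) (GRing.isLinear.Build _ _ _ _ _ (fdm_act_linear M)).

Lemma fdm_act_sum M (I : finType) (c : I -> F) (a : I -> A) (x : M) :
  fdm_act M (\sum_i c i *: a i) x = \sum_i c i *: fdm_act M (a i) x.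
Proof.
rewrite -[fdm_act M _]/(fdm_act_lin M _) linear_sum sum_lfunE.
by apply: eq_bigr => i _; rewrite linearZ scale_lfunE.
Qed.

Lemma Hom_modP M N (f : 'Hom(M, N)) :
  reflect (forall (a : A) (x : M), f (fdm_act M a x) = fdm_act N a (f x))
          (f \in Hom_mod M N).
Proof.
have kerE a : (f \in lker (linfun (@commutator M N a))) =
              (commutator_lin M N a f == 0).
  by rewrite memv_ker (lfunE (commutator_lin M N a)).
have commE a x :
    commutator_lin M N a f x = f (fdm_act M a x) - fdm_act N a (f x).
  by rewrite add_lfunE opp_lfunE !comp_lfunE.
apply: (iffP subv_bigcapP) => [fK a x|fA i _].
  apply/eqP; rewrite -subr_eq0 (coord_vbasis (memvf a)).
  rewrite !fdm_act_sum linear_sum.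
  rewrite -sumrB big1 // => i _; have := fK i isT.
  rewrite -memvE kerE => /eqP/lfunP/(_ x); rewrite commE zero_lfunE => fx0.
  by rewrite linearZ -scalerBr fx0 scaler0.
rewrite -memvE kerE; apply/eqP/lfunP=> x.
by rewrite commE fA subrr zero_lfunE.
Qed.

Definition isomorphic M N : Prop :=
  exists2 f : 'Hom(M, N), f \in Hom_mod M N & bijective f.

Lemma isomorphic_refl M : isomorphic M M.
Proof.
exists \1%VF; first by apply/Hom_modP=> a x; rewrite !id_lfunE.
by exists id => x; rewrite id_lfunE.
Qed.

Lemma isomorphic_sym M N : isomorphic M N -> isomorphic N M.
Proof.
case=> f /Hom_modP fA bij_f; have [g fK gK] := bij_f.
have kf : lker f == 0%VS by apply/lker0P; apply: bij_inj.
have eq_g y : (f^-1)%VF y = g y by rewrite -{1}(gK y) lker0_lfunK.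
exists (f^-1)%VF; last by exists f => y; rewrite eq_g.
by apply/Hom_modP=> a y; apply: (bij_inj bij_f); rewrite fA !eq_g !gK.
Qed.

Lemma isomorphic_trans M N L :
  isomorphic M N -> isomorphic N L -> isomorphic M L.
Proof.
case=> f /Hom_modP fA bij_f [g /Hom_modP gA bij_g].
exists (g \o f)%VF; first by apply/Hom_modP=> a x; rewrite !comp_lfunE fA gA.
by apply: (eq_bij (bij_comp bij_g bij_f)) => x; rewrite /= comp_lfunE.
Qed.

Section Submodule.
Variables (M : fdModule A) (U : {vspace M}) (submodU : is_submodule U).

Definition sub_act_fun (a : A) (u : subvs_of U) : subvs_of U :=
  vsproj U (fdm_act M a (vsval u)).

Definition sub_act (a : A) : 'End(subvs_of U) := linfun (sub_act_fun a).

Fact sub_act_fun_linear (a : A) : linear (sub_act_fun a).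
Proof. by move=> c u v; rewrite /sub_act_fun !linearP. Qed.

Lemma sub_actE a (u : subvs_of U) : vsval (sub_act a u) = fdm_act M a (vsval u).
Proof.
pose g : {linear subvs_of U -> subvs_of U} :=
  HB.pack (sub_act_fun a)
    (GRing.isLinear.Build _ _ _ _ _ (sub_act_fun_linear a)).
rewrite /sub_act (lfunE g) /= /sub_act_fun vsprojK //.
by apply: (subvP (submodU a)); rewrite memv_img ?subvsP.
Qed.

Fact sub_act_linear : linear sub_act.
Proof.
move=> c a b; apply/lfunP=> u; apply: val_inj => /=.
rewrite add_lfunE scale_lfunE linearP /= !sub_actE fdm_act_linear.
by rewrite add_lfunE scale_lfunE.
Qed.

Fact sub_act1 : sub_act 1 = \1%VF.
Proof.
by apply/lfunP=> u; apply: val_inj; rewrite /= sub_actE fdm_act1 !lfunE.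
Qed.

Fact sub_actM a b : sub_act (a * b) = (sub_act a \o sub_act b)%VF.
Proof.
apply/lfunP=> u; apply: val_inj.
by rewrite /= comp_lfunE !sub_actE fdm_actM comp_lfunE.
Qed.

Definition submodule : fdModule A := FdModule sub_act_linear sub_act1 sub_actM.

Definition sub_incl : 'Hom(submodule, M) := linfun (vsval : subvs_of U -> M).

Lemma sub_inclE (u : submodule) : sub_incl u = vsval (u : subvs_of U).
Proof. by rewrite /sub_incl lfunE. Qed.

Lemma sub_incl_hom : sub_incl \in Hom_mod submodule M.
Proof.
apply/Hom_modP=> a x; rewrite !sub_inclE.
exact: (sub_actE a (x : subvs_of U)).
Qed.

End Submodule.

Section FreeModule.
Variable d : nat.

Definition free_act_fun (a : A) (v : {ffun 'I_d -> A}) : {ffun 'I_d -> A} :=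
  [ffun i => a * v i].

Definition free_act (a : A) : 'End({ffun 'I_d -> A}) :=
  linfun (free_act_fun a).

Fact free_act_fun_linear (a : A) : linear (free_act_fun a).
Proof.
by move=> c u v; apply/ffunP=> i; rewrite !ffunE mulrDr scalerAr.
Qed.

Lemma free_actE a (v : {ffun 'I_d -> A}) i : free_act a v i = a * v i.
Proof.
pose g : {linear {ffun 'I_d -> A} -> {ffun 'I_d -> A}} :=
  HB.pack (free_act_fun a)
    (GRing.isLinear.Build _ _ _ _ _ (free_act_fun_linear a)).
by rewrite /free_act (lfunE g) ffunE.
Qed.

Fact free_act_linear : linear free_act.
Proof.
move=> c a b; apply/lfunP=> v; apply/ffunP=> i.
by rewrite add_lfunE scale_lfunE !ffunE !free_actE mulrDl scalerAl.
Qed.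

Fact free_act1 : free_act 1 = \1%VF.
Proof. by apply/lfunP=> v; apply/ffunP=> i; rewrite free_actE mul1r lfunE. Qed.

Fact free_actM a b : free_act (a * b) = (free_act a \o free_act b)%VF.
Proof.
by apply/lfunP=> v; apply/ffunP=> i; rewrite comp_lfunE !free_actE mulrA.
Qed.

Definition free_module : fdModule A :=
  FdModule free_act_linear free_act1 free_actM.

End FreeModule.

Section Ext1.
Variables M N : fdModule A.

(* The free presentation 0 -> K -> P -> M -> 0 in which P = A^d, d = dim M,   *)
(* and the i-th generator of P goes to the i-th vector of a basis of M.       *)
Definition pres_module : fdModule A := free_module (\dim {:M}).

Definition pres_fun (v : {ffun 'I_(\dim {:M}) -> A}) : M :=
  \sum_i fdm_act M (v i) (vbasis {:M})`_i.

Definition pres_map : 'Hom(pres_module, M) := linfun pres_fun.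

Fact pres_fun_linear : linear pres_fun.
Proof.
move=> c u v; rewrite /pres_fun scaler_sumr -big_split /=.
apply: eq_bigr => i _.
by rewrite !ffunE fdm_act_linear add_lfunE scale_lfunE.
Qed.

Lemma pres_mapE v : pres_map v = pres_fun v.
Proof.
pose g : {linear {ffun 'I_(\dim {:M}) -> A} -> M} :=
  HB.pack pres_fun (GRing.isLinear.Build _ _ _ _ _ pres_fun_linear).
exact: (lfunE g).
Qed.

Lemma pres_map_hom : pres_map \in Hom_mod pres_module M.
Proof.
apply/Hom_modP=> a v; rewrite !pres_mapE /pres_fun linear_sum.
apply: eq_bigr => i _ /=.
by rewrite free_actE fdm_actM comp_lfunE.
Qed.

Lemma pres_map_surj : limg pres_map = fullv.
Proof.
apply/vspaceP=> x; rewrite memvf; apply/memv_imgP.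
exists [ffun i => (coord (vbasis {:M}) i x)%:A]; first exact: memvf.
rewrite pres_mapE /pres_fun [LHS](coord_vbasis (memvf x)).
apply: eq_bigr => i _; rewrite ffunE -[fdm_act M _]/(fdm_act_lin M _) linearZ.
by rewrite scale_lfunE /= fdm_act1 id_lfunE.
Qed.

Fact pres_ker_submodule : is_submodule (lker pres_map).
Proof.
move=> a; apply/subvP=> _ /memv_imgP[v vK ->]; rewrite memv_ker.
rewrite (Hom_modP _ pres_map_hom) //.
by move: vK; rewrite memv_ker => /eqP->; rewrite linear0.
Qed.

Definition pres_ker : fdModule A := submodule pres_ker_submodule.

(* The map Hom_A(P, N) -> Hom_A(K, N) induced by the inclusion K -> P.        *)
Definition pres_restr (f : 'Hom(pres_module, N)) : 'Hom(pres_ker, N) :=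
  (f \o sub_incl pres_ker_submodule)%VF.

Definition pres_restr_img : {vspace 'Hom(pres_ker, N)} :=
  (linfun pres_restr @: Hom_mod pres_module N)%VS.

Fact pres_restr_linear : linear pres_restr.
Proof.
move=> c f g; apply/lfunP=> x.
by rewrite /pres_restr !(add_lfunE, scale_lfunE, comp_lfunE).
Qed.

Lemma pres_restr_img_sub : (pres_restr_img <= Hom_mod pres_ker N)%VS.
Proof.
pose g : {linear 'Hom(pres_module, N) -> 'Hom(pres_ker, N)} :=
  HB.pack pres_restr (GRing.isLinear.Build _ _ _ _ _ pres_restr_linear).
apply/subvP=> _ /memv_imgP[f /Hom_modP fA ->].
have -> : linfun pres_restr f = pres_restr f by exact: (lfunE g).
apply/Hom_modP=> a x.
rewrite /pres_restr comp_lfunE [X in fdm_act N a X]comp_lfunE -fA.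
apply: (congr1 f).
exact: (Hom_modP _ (sub_incl_hom pres_ker_submodule)).
Qed.

(* Applying Hom_A(-, N) to the presentation, Ext^1_A(M, N) is the cokernel of *)
(* Hom_A(P, N) -> Hom_A(K, N), since Ext^1_A(P, N) = 0; the subtraction is    *)
(* exact by pres_restr_img_sub.                                               *)
Definition ext1_dim : nat :=
  (\dim (Hom_mod pres_ker N) - \dim pres_restr_img)%N.

End Ext1.
End Modules.

Record quiver := Quiver {
  vertex : Type;
  arrows : vertex -> vertex -> nat
}.

(* v 0 -> v 1 -> ... -> v k = v 0 with k > 0; a loop is the case k = 1.       *)
Definition directed_cycle (Q : quiver) (k : nat) (v : nat -> vertex Q) : Prop :=
  [/\ (0 < k)%N, v k = v 0%N &
      forall i, (i < k)%N -> (0 < arrows (v i) (v i.+1))%N].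

Definition acyclic (Q : quiver) : Prop :=
  ~ exists k (v : nat -> vertex Q), directed_cycle k v.

Section QuiverOfAlgebra.
Variables (F : fieldType) (A : falgType F).

Definition simple_class : Type :=
  {X : fdModule A -> Prop | exists S, is_simple S /\ X = isomorphic S}.

Definition class_repr (X : simple_class) : fdModule A := projT1 (cid (svalP X)).

Lemma class_reprP (X : simple_class) :
  is_simple (class_repr X) /\ sval X = isomorphic (class_repr X).
Proof. exact: (projT2 (cid (svalP X))). Qed.

(* The dimension does not depend on the chosen representatives.               *)
Definition algebra_quiver : quiver :=
  {| vertex := simple_class;
     arrows X Y := ext1_dim (class_repr X) (class_repr Y) |}.

End QuiverOfAlgebra.

(* Main.v *)
(* Call apex of a simple module S the least rank of a map acting on S by a     *)
(* nonzero operator, and say that S has sign type if, for some set X of that   *)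
(* size, S contains a nonzero vector supported on X (g and h act on it alike   *)
(* when they agree on X) on which Sym X acts by the sign character. (These are *)
(* the exterior powers of the augmentation submodule of the natural module.)   *)
(* - If S has sign type and apex r, it is a quotient of the r-th exterior      *)
(*   power of the natural module, which is projective, and the kernel is       *)
(*   spanned by boundaries of r-simplices. So an arrow from S ends at a module *)
(*   of sign type with apex r + 1.                                             *)
(* - Otherwise the module induced from Sym X by the X-supported vectors of S   *)
(*   is S itself: a vector of it killed in S gives, after applying a map of    *)
(*   minimal rank not killing it, a sign vector of S. So an arrow from S ends  *)
(*   at a module of smaller apex.                                              *)
(* Hence n - apex (sign type) and n + apex (other types) define a function on  *)
(* the vertices that decreases along arrows.                                   *)

Require Import Defs.
From HB Require Import structures.
From mathcomp Require Import all_boot all_order all_algebra all_fingroup all_field.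
From mathcomp Require Import boolp reals.
From mathcomp.real_closed Require Import complex.

Set Implicit Arguments.
Unset Strict Implicit.
Unset Printing Implicit Defensive.

Import GRing.Theory.
Local Open Scope ring_scope.

(** Every arrow strictly lowers [vertex_height] ([ext1_height]), so no path closes up. To control an
    arrow from [S] to [T], [ext1_cocycle] turns it into a linear map [phi] from the algebra to [T]
    that commutes with the action on the annihilator of a chosen vector [m] of [S] and is nonzero
    somewhere on that annihilator. Averaging over [Sym X] makes [phi] at a map [g] depend only on
    [g] restricted to [X] and inherit the sign symmetry of [m].

    If [S] is not of sign type, [component_sign] splits each relation among the vectors [k m] into
    one relation for each image set [k @: X]. If [T] had apex at least that of [S], [phi] would
    vanish on every piece ([ext1_nonsign]).

    If [S] is of sign type with apex r, [phi] is an alternating function of r points. By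
    [subst_relation], its value on a relation is a combination of its values on boundaries of
    r-simplices. A nonzero such value is a sign vector of [T] supported on the r + 1 vertices
    ([ext1_sign]). *)

(** * Nonzero Ext^1 read off a cyclic generator *)

Section ExtensionCriterion.
Variables (F : fieldType) (A : falgType F).
Implicit Types M N : fdModule A.

Lemma fdm_actD M (a b : A) (x : M) :
  fdm_act M (a + b) x = fdm_act M a x + fdm_act M b x.
Proof. by rewrite -[fdm_act M (a + b)]/(fdm_act_lin M _) linearD add_lfunE. Qed.

Lemma fdm_actZ M c (a : A) (x : M) : fdm_act M (c *: a) x = c *: fdm_act M a x.
Proof. by rewrite -[fdm_act M (c *: a)]/(fdm_act_lin M _) linearZ scale_lfunE. Qed.

Lemma fdm_actB M (a b : A) (x : M) :
  fdm_act M (a - b) x = fdm_act M a x - fdm_act M b x.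
Proof. by rewrite fdm_actD -scaleN1r fdm_actZ scaleN1r. Qed.

Lemma fdm_actE M (a b : A) (x : M) :
  fdm_act M (a * b) x = fdm_act M a (fdm_act M b x).
Proof. by rewrite fdm_actM comp_lfunE. Qed.

Fact orbit_map_linear M (x : M) : linear (fun a => fdm_act M a x).
Proof. by move=> c a b; rewrite fdm_actD fdm_actZ. Qed.

Definition orbit_map M (x : M) : {linear A -> M} :=
  HB.pack (fun a => fdm_act M a x)
    (GRing.isLinear.Build _ _ _ _ _ (orbit_map_linear x)).

Definition orbit_hom M (x : M) : 'Hom(A, M) := linfun (orbit_map x).

Lemma orbit_homE M (x : M) a : orbit_hom x a = fdm_act M a x.
Proof. exact: (lfunE (orbit_map x)). Qed.

Lemma orbit_submodule M (x : M) : is_submodule (limg (orbit_hom x)).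
Proof.
move=> a; apply/subvP=> _ /memv_imgP[_ /memv_imgP[b _ ->] ->].
apply/memv_imgP; exists (a * b); first exact: memvf.
by rewrite !orbit_homE fdm_actE.
Qed.

Lemma simple_cyclic M (x : M) : is_simple M -> x != 0 ->
  forall y, exists a, y = fdm_act M a x.
Proof.
move=> [_ simM] x0 y; have := simM _ (orbit_submodule x); case=> [z|full].
  have : x \in limg (orbit_hom x).
    apply/memv_imgP; exists 1; first exact: memvf.
    by rewrite orbit_homE fdm_act1 id_lfunE.
  by rewrite z memv0 (negPf x0).
have : y \in limg (orbit_hom x) by rewrite full memvf.
by case/memv_imgP=> a _ ->; exists a; rewrite orbit_homE.
Qed.

Lemma ext1_gt0 M N : (0 < ext1_dim M N)%N -> exists2 f : 'Hom(pres_ker M, N),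
  f \in Hom_mod (pres_ker M) N & f \notin pres_restr_img M N.
Proof.
rewrite /ext1_dim subn_gt0 => lt_dim; apply: contrapT => none.
have sub : (Hom_mod (pres_ker M) N <= pres_restr_img M N)%VS.
  by apply/subvP=> f fH; apply/negPn/negP => fN; apply: none; exists f.
by move: lt_dim; rewrite ltnNge dimvS.
Qed.

Lemma pres_restr_imgP M N (f : 'Hom(pres_ker M, N)) (g : 'Hom(pres_module M, N)) :
  g \in Hom_mod (pres_module M) N ->
  (forall u : pres_ker M, g (vsval u) = f u) -> f \in pres_restr_img M N.
Proof.
move=> gH gf; apply/memv_imgP; exists g => //.
pose h : {linear 'Hom(pres_module M, N) -> 'Hom(pres_ker M, N)} :=
  HB.pack (@pres_restr F A M N)
    (GRing.isLinear.Build _ _ _ _ _ (@pres_restr_linear F A M N)).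
have -> : linfun (@pres_restr F A M N) g = pres_restr g by exact: (lfunE h).
apply/lfunP=> u.
by rewrite /pres_restr comp_lfunE sub_inclE gf.
Qed.

(** Here [phi x] is [f (x p0)], for a homomorphism [f] on the kernel K that does not extend to the
    free module P. If [phi] vanished on the annihilator of the generator, [f] would factor through
    K/(K ∩ A p0) = P/(A p0), and so would extend to P. *)
Lemma ext1_gt0_cyclic M N (p0 : pres_module M) :
  (forall y, exists a, y = fdm_act M a (pres_map M p0)) ->
  (0 < ext1_dim M N)%N -> exists phi : {linear A -> N},
    [/\ forall x, fdm_act _ x p0 = 0 -> phi x = 0,
        forall a x, fdm_act M x (pres_map M p0) = 0 ->
          phi (a * x) = fdm_act N a (phi x) &
        exists2 x, fdm_act M x (pres_map M p0) = 0 & phi x != 0].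
Proof.
set m := pres_map M p0 => gen /ext1_gt0[f /Hom_modP fA fN].
pose K := lker (pres_map M).
(* A linear projection defines [phi] on all of [A]; compatibility with the action is claimed only
   where [x p0] lies in [K]. *)
pose pr (y : pres_module M) : pres_ker M := vsproj K y.
have phiL : linear (fun x => f (pr (fdm_act (pres_module M) x p0))).
  by move=> c a b; rewrite /pr fdm_actD fdm_actZ !linearP.
pose phi : {linear A -> N} := HB.pack (fun x => f (pr (fdm_act _ x p0)))
    (GRing.isLinear.Build _ _ _ _ _ phiL).
have pmA a y : pres_map M (fdm_act _ a y) = fdm_act M a (pres_map M y).
  exact: (Hom_modP _ (pres_map_hom M)).
have prK y : pres_map M y = 0 -> vsval (pr y) = y.
  by move=> y0; rewrite vsprojK // memv_ker y0.
have prA a y : pres_map M y = 0 ->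
    pr (fdm_act _ a y) = fdm_act (pres_ker M) a (pr y).
  move=> y0; apply: val_inj => /=.
  rewrite [LHS]prK ?pmA ?y0 ?linear0 //; apply/esym.
  apply: etrans (sub_actE (@pres_ker_submodule F A M) a (pr y)) _.
  by congr (fdm_act _ a _); apply: prK.
have phiE x : phi x = f (pr (fdm_act (pres_module M) x p0)) by [].
exists phi; split=> [x x0|a x x0|].
- by rewrite phiE x0 /pr !linear0.
- by rewrite !phiE fdm_actE -fA prA // pmA.
apply: contrapT => none.
have phi0 x : fdm_act M x m = 0 -> phi x = 0.
  by move=> x0; apply/eqP/negPn/negP => nz; apply: none; exists x.
pose h := orbit_hom m.
have hK y : fdm_act M ((h^-1)%VF y) m = y.
  have : y \in limg h.
    have [a ->] := gen y; apply/memv_imgP; exists a; first exact: memvf.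
    by rewrite orbit_homE.
  by move/limg_lfunVK; rewrite orbit_homE.
(* Subtracting a multiple of [p0] moves [y] into the kernel. The choice of multiplier is immaterial,
   by [phi0]. *)
pose d (y : pres_module M) := y - fdm_act _ ((h^-1)%VF (pres_map M y)) p0.
have d0 y : pres_map M (d y) = 0 by rewrite /d linearB /= pmA hK subrr.
have gL : linear (fun y : pres_module M => f (pr (d y))).
  move=> c y z; rewrite -linearP -linearP; congr (f (pr _)).
  by rewrite /d !linearP fdm_actD fdm_actZ /= scalerBr opprD addrACA.
pose g0 : {linear pres_module M -> N} := HB.pack (fun y => f (pr (d y)))
    (GRing.isLinear.Build _ _ _ _ _ gL).
have gE y : linfun g0 y = f (pr (d y)) by exact: (lfunE g0).
have fprB y z : f (pr y) - f (pr z) = f (pr (y - z)) by rewrite /pr !linearB.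
case/negP: fN; apply: (@pres_restr_imgP _ _ _ (linfun g0)).
  apply/Hom_modP=> a y; rewrite !gE -fA -prA //.
  apply/eqP; rewrite -subr_eq0 fprB.
  set x := (h^-1)%VF (pres_map M y).
  set x' := (h^-1)%VF (pres_map M (fdm_act _ a y)).
  have -> : d (fdm_act _ a y) - fdm_act _ a (d y) = fdm_act _ (a * x - x') p0.
    by rewrite /d -/x -/x' linearB fdm_actB fdm_actE opprB addrC addrA subrK.
  rewrite -phiE phi0 // fdm_actB fdm_actE !hK pmA.
  by rewrite subrr.
move=> u; rewrite gE /d.
have u0 : pres_map M (vsval u) = 0.
  by apply/eqP; rewrite -memv_ker subvsP.
rewrite u0 linear0 -[fdm_act _ 0]/(fdm_act_lin _ 0) linear0 lfunE /= subr0.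
by congr (f _); apply: val_inj; rewrite /= prK.
Qed.

Lemma pres_map_lift M : exists s : {linear M -> pres_module M},
  forall x, pres_map M (s x) = x.
Proof.
exists (pres_map M)^-1%VF => x.
by apply: limg_lfunVK; rewrite pres_map_surj memvf.
Qed.

End ExtensionCriterion.

(** * The basis of the monoid algebra *)

Section MonoidAlgebraBasis.
Variables (F : fieldType) (M : finMonoidType).

Definition delta (g : M) : monoid_algebra F M := [ffun h => (h == g)%:R].

Lemma delta_mul (g h : M) : delta g * delta h = delta (g * h)%g.
Proof.
apply/ffunP=> m.
change (malg_coef (malg_mul (delta g) (delta h)) m = delta (g * h)%g m).
rewrite malg_mulE (bigD1 g) //= [X in _ + X]big1 ?addr0 => [|x xg]; last first.
  by rewrite big1 // => y _; rewrite /malg_coef ffunE (negPf xg) mul0r.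
rewrite big_mkcond (bigD1 h) //= big1 ?addr0 => [|y yh]; last first.
  by case: ifP => // _; rewrite /malg_coef [X in _ * X]ffunE (negPf yh) mulr0.
rewrite /malg_coef !ffunE !eqxx mulr1 [m == _]eq_sym.
by case: eqP.
Qed.

Lemma delta1 : delta 1%g = 1.
Proof. by apply/ffunP=> m; rewrite !ffunE. Qed.

Lemma malg_sum (x : monoid_algebra F M) : x = \sum_g malg_coef x g *: delta g.
Proof.
apply/ffunP=> m; rewrite sum_ffunE (bigD1 m) //= big1 ?addr0 => [|g gm].
  by rewrite !ffunE eqxx [RHS]mulr1.
by rewrite !ffunE eq_sym (negPf gm) [LHS]mulr0.
Qed.

End MonoidAlgebraBasis.

(** * Maps, supported vectors, equivariant lifting and the apex *)

Section Transformations.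
Variable n : nat.
Implicit Types (f g h : full_transf n) (X Y : {set 'I_n}).

Definition tfun f : 'I_n -> 'I_n := (f : {ffun 'I_n -> 'I_n}).
Local Coercion tfun : full_transf >-> Funclass.

Definition transf (u : 'I_n -> 'I_n) : full_transf n := finfun u.

Lemma transfE u x : transf u x = u x.
Proof. by rewrite /tfun ffunE. Qed.

Lemma transfP f g : f =1 g -> f = g.
Proof. by move=> fg; apply/ffunP. Qed.

Lemma tmulE f g x : tfun (f * g)%g x = f (g x).
Proof. by rewrite [LHS]ffunE. Qed.

Lemma tone x : tfun 1%g x = x.
Proof. by rewrite [LHS]ffunE. Qed.

(** Permutations multiply from left to right, whereas maps compose from right to left. *)
Lemma transf_perm_mul (s t : {perm 'I_n}) :
  (transf s * transf t)%g = transf (t * s)%g.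
Proof. by apply: transfP => x; rewrite tmulE !transfE permM. Qed.

Definition rank f : nat := #|f @: [set: 'I_n]|.

Lemma rank_mulr f g : (rank (f * g)%g <= rank f)%N.
Proof.
apply/subset_leq_card/subsetP=> _ /imsetP[x _ ->]; rewrite tmulE.
exact: imset_f.
Qed.

Lemma rank_le f : (rank f <= n)%N.
Proof. by rewrite /rank -[X in (_ <= X)%N](card_ord n) max_card. Qed.

Definition retract X (x0 : 'I_n) : full_transf n :=
  transf (fun x => if x \in X then x else x0).

Lemma retract_id X x0 : {in X, retract X x0 =1 id}.
Proof. by move=> x xX; rewrite transfE xX. Qed.

Lemma retract_in X x0 x : x0 \in X -> retract X x0 x \in X.
Proof. by move=> x0X; rewrite transfE; case: ifP. Qed.

Lemma rank_retract X x0 : x0 \in X -> rank (retract X x0) = #|X|.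
Proof.
move=> x0X; congr #|pred_of_set _|; apply/setP=> x; apply/imsetP/idP.
  by case=> y _ ->; apply: retract_in.
by move=> xX; exists x => //; rewrite retract_id.
Qed.

Section Action.
Variables (F : fieldType).
Local Notation A := (monoid_algebra F (full_transf n)).
Implicit Types M N : fdModule A.

Definition tact M g : 'End(M) := fdm_act M (delta F g).

Lemma tactM M g h (v : M) : tact M (g * h)%g v = tact M g (tact M h v).
Proof. by rewrite /tact -delta_mul fdm_actE. Qed.

Lemma tact1 M (v : M) : tact M 1%g v = v.
Proof. by rewrite /tact delta1 fdm_act1 id_lfunE. Qed.

Lemma tactZ M g c (v : M) : tact M g (c *: v) = c *: tact M g v.
Proof. exact: linearZ. Qed.

Lemma fdm_act_tact M (x : A) (v : M) :
  fdm_act M x v = \sum_g malg_coef x g *: tact M g v.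
Proof. by rewrite [in LHS](malg_sum x) fdm_act_sum. Qed.

Definition supported M X (v : M) : Prop :=
  forall g h, {in X, g =1 h} -> tact M g v = tact M h v.

Definition alternating M X (v : M) : Prop :=
  forall i j, i \in X -> j \in X -> i != j -> tact M (transf (tperm i j)) v = - v.

Lemma supported_id M X (v : M) g : supported X v -> {in X, g =1 id} -> tact M g v = v.
Proof. by move=> sv gX; rewrite (sv g 1%g) ?tact1 // => x /gX->; rewrite tone. Qed.

Lemma transf_permK M X (v : M) (s : {perm 'I_n}) :
  tact M (transf s) (tact M (transf s^-1%g) v) = v.
Proof.
rewrite -tactM transf_perm_mul mulVg -[RHS]tact1; congr (tact M _ v).
by apply: transfP => x; rewrite transfE perm1 tone.
Qed.

Section Averaging.
Variables (M P : fdModule A) (p : 'Hom(P, M)) (s : {linear M -> P}).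
Hypotheses (p_hom : p \in Hom_mod P M) (sK : forall v, p (s v) = v).
Hypothesis charF : [pchar F] =i pred0.
Variables (X : {set 'I_n}) (x0 : 'I_n).
Hypothesis x0X : x0 \in X.

(** The retraction makes all values supported on [X], and the sum over [Sym X] makes the map
    equivariant. On vectors supported on [X] the retraction acts trivially, so there it remains a
    section. *)
Definition avg_section (v : M) : P :=
  (#|X|`!)%:R^-1 *: \sum_(t in Sym X)
    tact P (transf t) (tact P (retract X x0) (s (tact M (transf t^-1%g) v))).

Fact avg_section_linear : linear avg_section.
Proof.
move=> c u v; rewrite /avg_section scalerA mulrC -scalerA -scalerDr; congr (_ *: _).
by rewrite scaler_sumr -big_split; apply: eq_bigr => t _; rewrite !linearP.
Qed.

HB.instance Definition _ := GRing.isLinear.Build F M P _ avg_section avg_section_linear.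

Lemma avg_sectionK v : supported X v -> p (avg_section v) = v.
Proof.
move=> sv; have pA g u : p (tact P g u) = tact M g (p u) by apply: (Hom_modP _ p_hom).
rewrite /avg_section linearZ linear_sum /=.
rewrite (eq_bigr (fun=> v)) => [|t tX].
  rewrite sumr_const card_Sym -scaler_nat scalerA mulVf ?scale1r //.
  by move/pcharf0P: charF => ->; rewrite -lt0n fact_gt0.
rewrite /= !pA sK -[tact M (retract _ _) _]tactM.
rewrite (sv _ (transf t^-1%g)) ?transf_permK // => x xX.
rewrite tmulE retract_id // transfE perm_closed //.
by rewrite inE in tX; apply: perm_onV.
Qed.

Lemma avg_section_supported v : supported X (avg_section v).
Proof.
move=> g h gh; rewrite /avg_section !linearZ !linear_sum /=; congr (_ *: _).
apply: eq_bigr => t; rewrite inE => tX; rewrite -!tactM.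
congr (tact P _ _); apply: transfP => x; rewrite !tmulE transfE gh //.
by rewrite perm_closed // retract_in.
Qed.

Lemma avg_section_perm v (t : {perm 'I_n}) : perm_on X t ->
  tact P (transf t) (avg_section v) = avg_section (tact M (transf t) v).
Proof.
move=> tX; rewrite /avg_section linearZ linear_sum /=; congr (_ *: _).
rewrite [RHS](reindex_inj (mulIg t)) /=.
apply: eq_big => [u|u _]; first by rewrite groupMr // inE.
rewrite -tactM transf_perm_mul; congr (tact P _ (tact P _ (s _))).
by rewrite -tactM transf_perm_mul invMg mulKVg.
Qed.
End Averaging.

Lemma extend_injection (X : {set 'I_n}) (u : 'I_n -> 'I_n) :
  {in X &, injective u} -> {in X, forall x, u x \in X} ->
  exists2 t : {perm 'I_n}, perm_on X t & {in X, t =1 u}.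
Proof.
move=> uI uX; pose v x := if x \in X then u x else x.
have vI : injective v.
  move=> x y; rewrite /v; case: ifPn => xX; case: ifPn => yX //.
  - exact: uI.
  - by move=> e; move: yX; rewrite -e uX.
  - by move=> e; move: xX; rewrite e uX.
exists (perm vI); last by move=> x xX; rewrite permE /v xX.
by apply/subsetP=> x; rewrite inE permE /v; case: ifP => //; rewrite eqxx.
Qed.

(** A left inverse of [g] on [X] when [g] is injective there; points outside [g @: X] go to the
    default [x0]. *)
Definition back X (x0 : 'I_n) g : full_transf n :=
  transf (fun y => odflt x0 [pick x in X | g x == y]).

Lemma backK X x0 g : {in X &, injective g} -> {in X, forall x, back X x0 g (g x) = x}.
Proof.
move=> gI x xX; rewrite transfE; case: pickP => [y /andP[yX /eqP e]|/(_ x)] /=.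
  exact: gI.
by rewrite xX eqxx.
Qed.

Section Lifting.
Variables (S : fdModule A) (X : {set 'I_n}) (x0 : 'I_n) (m : S).
Hypotheses (charF : [pchar F] =i pred0) (x0X : x0 \in X) (suppm : supported X m).

(* Maschke: averaging a linear section of the presentation over [Sym X]. *)
Lemma equivariant_lift : exists p0 : pres_module S,
  [/\ pres_map S p0 = m, supported X p0, alternating X m -> alternating X p0 &
      forall (Y : {set 'I_n}) (c : full_transf n -> F), #|Y| = #|X| ->
        \sum_(k : full_transf n | k @: X == Y) c k *: tact S k m = 0 ->
        \sum_(k : full_transf n | k @: X == Y) c k *: tact _ k p0 = 0].
Proof.
have [s sK] := pres_map_lift S.
pose s' := avg_section s X x0 : {linear S -> pres_module S}.
have s'supp : supported X (s' m) by apply: avg_section_supported.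
exists (s' m); split=> //.
- by rewrite (avg_sectionK (pres_map_hom S) sK charF x0 suppm).
- move=> altm i j iX jX ij; have tX : perm_on X (tperm i j).
    by apply: subset_trans (tperm_on i j) _; apply/subsetP=> z /set2P[]->.
  by rewrite [LHS](avg_section_perm s x0 m tX) altm // [LHS](linearN s').
move=> Y c cardY.
case: (pickP (fun k : full_transf n => k @: X == Y)) => [k0 /eqP k0X|none]; last first.
  by move=> _; rewrite big_pred0.
have injX (k : full_transf n) : k @: X = Y -> {in X &, injective k}.
  by move=> kX; apply/imset_injP; rewrite kX cardY.
(* On [X], [k] is [k0] after a permutation of [X]; by equivariance, [k p0] is the image of [k m]
   under a linear map that does not depend on [k]. *)
have kE (k : full_transf n) : k @: X == Y ->
    tact _ k (s' m) = tact _ k0 (s' (tact S (back X x0 k0) (tact S k m))).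
  move/eqP=> kX; have k0k x : x \in X -> exists2 y, y \in X & k x = k0 y.
    by move=> xX; apply/imsetP; rewrite k0X -kX imset_f.
  have k0K := backK x0 (injX k0 k0X).
  have [|x xX|t tX tE] := @extend_injection X (back X x0 k0 \o k).
  - move=> x y xX yX /=; have [z zX kx] := k0k x xX; have [w wX ky] := k0k y yX.
    rewrite kx ky !k0K // => zw; apply: (injX k kX) => //.
    by rewrite kx ky zw.
  - by have [y yX e] := k0k x xX; rewrite /= e k0K.
  rewrite (s'supp _ (k0 * transf t)%g) => [|x xX].
    rewrite tactM [X in tact _ k0 X](avg_section_perm s x0 m tX).
    congr (tact _ k0 (s' _)).
    rewrite -tactM; apply: suppm => x xX.
    by rewrite tmulE transfE tE.
  by rewrite tmulE transfE tE //=; have [y yX ->] := k0k x xX; rewrite k0K.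
move=> c0; rewrite (eq_bigr (fun k => tact _ k0
    (s' (tact S (back X x0 k0) (c k *: tact S k m))))) => [|k kX].
  by rewrite -!linear_sum c0 !linear0.
have s'Z a u : s' (a *: u) = a *: s' u by exact: (linearZ_LR s').
by rewrite kE // (tactZ _ (c k) (tact S k m)) s'Z [RHS]tactZ.
Qed.

End Lifting.

Section Orbits.
Variable M : fdModule A.

(** A nonzero [u] generates [M], so [e] would annihilate all of [M]. *)
Lemma simple_killed (e : full_transf n) (v u : M) : is_simple M ->
  tact M e v != 0 -> (forall g, tact M (e * g)%g u = 0) -> u = 0.
Proof.
move=> simM ev eu; apply/eqP/negPn/negP => u0.
have [x vE] := simple_cyclic simM u0 v.
case/eqP: ev; rewrite vE fdm_act_tact linear_sum big1 // => g _.
by rewrite linearZ /= -tactM eu scaler0.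
Qed.

Definition apex_transf : full_transf n := [arg min_(g < 1%g | tact M g != 0) rank g].
Definition apex : nat := rank apex_transf.

Lemma apexP : is_simple M -> tact M apex_transf != 0 /\
  forall g, tact M g != 0 -> (apex <= rank g)%N.
Proof.
move=> simM; rewrite /apex /apex_transf; case: arg_minnP => //.
(* The identity, default of the minimum, acts nontrivially because [M] is nonzero. *)
apply/eqP=> /lfunP m0; case: simM => /eqP[]; apply/eqP; rewrite -subv0.
apply/subvP=> v _; rewrite memv0 -[v]tact1 m0.
by rewrite zero_lfunE.
Qed.

Lemma low_rank g (v : M) : is_simple M -> (rank g < apex)%N -> tact M g v = 0.
Proof.
move=> simM; rewrite ltnNge => /negP lt; have [_ min] := apexP simM.
suff /eqP -> : tact M g == 0 by rewrite zero_lfunE.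
by apply/negPn/negP => /min.
Qed.

Lemma apexE r (v : M) g : is_simple M -> tact M g v != 0 -> rank g = r ->
  (forall g (u : M), (rank g < r)%N -> tact M g u = 0) -> apex = r.
Proof.
move=> simM gv gr low; have [m0 min] := apexP simM; apply/eqP; rewrite eqn_leq.
rewrite -{1}gr min /=; last by apply: contraNneq gv => ->; rewrite zero_lfunE.
rewrite leqNgt; apply: contra m0 => lt; apply/eqP/lfunP=> u.
by rewrite zero_lfunE low.
Qed.

Lemma apex_vector : is_simple M ->
  exists X (m : M), [/\ #|X| = apex, m != 0 & supported X m].
Proof.
move=> simM; have [m0 _] := apexP simM.
have [u gu] : exists u, tact M apex_transf u != 0.
  apply: contrapT => none; case/eqP: m0; apply/lfunP=> u; rewrite zero_lfunE.
  by apply/eqP/negPn/negP => nz; apply: none; exists u.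
exists (apex_transf @: [set: 'I_n]), (tact M apex_transf u); split=> // g h gh.
rewrite -!tactM; congr (tact M _ _); apply: transfP => x; rewrite !tmulE gh //.
exact: imset_f.
Qed.

Definition sign_type : Prop := exists X (v : M),
  [/\ #|X| = apex, v != 0, supported X v & alternating X v].

End Orbits.
End Action.
End Transformations.

Local Coercion tfun : full_transf >-> Funclass.

(** * Splitting a relation by image sets *)

Section StandardModules.
Variables (n : nat) (F : fieldType).
Local Notation A := (monoid_algebra F (full_transf n)).
Implicit Types (M N S T : fdModule A) (a b f g h k : full_transf n).
Implicit Types X Y Z : {set 'I_n}.

Lemma mem_tperm_imset i j x Y :
  (x \in transf (tperm i j) @: Y) = (tperm i j x \in Y).
Proof.
apply/imsetP/idP => [[y yY ->]|tY]; first by rewrite transfE tpermK.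
by exists (tperm i j x); rewrite // transfE tpermK.
Qed.

Lemma imset_tperm2 i j Y : transf (tperm i j) @: (transf (tperm i j) @: Y) = Y.
Proof. by apply/setP=> x; rewrite !mem_tperm_imset tpermK. Qed.

Lemma card_tperm i j Y : #|transf (tperm i j) @: Y| = #|Y|.
Proof. by apply: card_imset => x y; rewrite !transfE => /perm_inj. Qed.

Lemma imset_tmul f g X : tfun (f * g)%g @: X = f @: (g @: X).
Proof. by rewrite -imset_comp; apply: eq_imset => x; rewrite tmulE. Qed.

(** Precomposing [g] with a retraction onto [X] does not change [g m] and cuts the rank down to at
    most the size of [g @: X]. *)
Lemma supported_low M X (m : M) g : is_simple M -> (0 < #|X|)%N ->
  supported X m -> (#|g @: X| < apex M)%N -> tact M g m = 0.
Proof.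
move=> simM /card_gt0P[x0 x0X] suppm low.
rewrite (suppm g (g * retract X x0)%g) => [|x xX]; last by rewrite tmulE retract_id.
apply: low_rank => //; apply: leq_ltn_trans low; apply: subset_leq_card.
by apply/subsetP=> _ /imsetP[x _ ->]; rewrite tmulE imset_f // retract_in.
Qed.

Definition collapse (i j : 'I_n) : full_transf n :=
  transf (fun x => if x == j then i else x).

Section Components.
Variables (S : fdModule A) (X : {set 'I_n}) (m : S) (c : full_transf n -> F).
Hypotheses (simS : is_simple S) (X_gt0 : (0 < #|X|)%N).
Hypotheses (cardX : #|X| = apex S) (suppm : supported X m).
Hypothesis cm0 : \sum_k c k *: tact S k m = 0.

(* With x = \sum_k c k k, these are the components of a x in the module induced *)
(* from the symmetric group on X, each of them evaluated in S.                 *)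
Definition component (a : full_transf n) (Y : {set 'I_n}) : S :=
  \sum_(k : full_transf n | tfun (a * k)%g @: X == Y) c k *: tact S (a * k)%g m.

Lemma componentM (b a : full_transf n) Y :
  component (b * a)%g Y =
  \sum_(Z : {set 'I_n} | b @: Z == Y) tact S b (component a Z).
Proof.
rewrite /component (partition_big (fun k : full_transf n => tfun (a * k)%g @: X)
  (fun Z : {set 'I_n} => b @: Z == Y)) => [|k] /=; last first.
  by rewrite -mulgA imset_tmul.
apply: eq_bigr => Z /eqP bZ; rewrite linear_sum /=; apply: eq_big => [k|k _].
  rewrite -mulgA imset_tmul.
  by case: (tfun (a * k)%g @: X =P Z) => [->|]; rewrite ?andbF // bZ eqxx.
by rewrite tactZ -tactM mulgA.
Qed.

Lemma component_sum a : \sum_Y component a Y = 0.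
Proof.
transitivity (tact S a (\sum_k c k *: tact S k m)); last by rewrite cm0 linear0.
rewrite linear_sum /= [RHS](partition_big
  (fun k : full_transf n => tfun (a * k)%g @: X) predT) //=.
by apply: eq_bigr => Y _; apply: eq_bigr => k _; rewrite tactM tactZ.
Qed.

Lemma component_supported a Y : supported Y (component a Y).
Proof.
move=> g h gh; rewrite !linear_sum /=; apply: eq_bigr => k /eqP kY.
rewrite !tactZ -!tactM; congr (_ *: _); apply: suppm => x xX.
by rewrite [LHS]tmulE [RHS]tmulE gh // -kY imset_f.
Qed.

Lemma component_neq0 a Y : component a Y != 0 ->
  #|Y| = apex S /\ Y \subset a @: [set: 'I_n].
Proof.
move=> Y0; have [k /eqP kY km] : exists2 k : full_transf n,
    tfun (a * k)%g @: X == Y & tact S (a * k)%g m != 0.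
  apply: contrapT => none; case/eqP: Y0; rewrite /component big1 // => k kY.
  apply/eqP; rewrite scaler_eq0; apply/orP; right.
  by apply/negPn/negP => nz; apply: none; exists k.
split; last by rewrite -kY imset_tmul imsetS ?subsetT.
apply/eqP; rewrite eqn_leq -{1}cardX -{1}kY leq_imset_card leqNgt -kY.
by apply: contra km => low; rewrite (supported_low simS X_gt0 suppm low).
Qed.

(** Collapsing [j] to [i] lowers the rank of [a], so the component of [b * a] at [Y] vanishes. Only
    two sets with image [Y] contribute to it: [Y], fixed by [b], and its transpose, on which [b]
    acts as the transposition. *)
Lemma component_exchange a i j Y :
  (forall b, (rank (b * a)%g < rank a)%N -> forall Z, component (b * a)%g Z = 0) ->
  #|Y| = apex S -> i \in Y -> j \notin Y ->
  i \in a @: [set: 'I_n] -> j \in a @: [set: 'I_n] ->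
  tact S (transf (tperm i j)) (component a Y) =
  - component a (transf (tperm i j) @: Y).
Proof.
move=> min cardY iY jY ia ja; have ij : i != j by apply: contraNneq jY => <-.
set t := transf (tperm i j); pose b := collapse i j.
have bE x : b x = if x == j then i else x by rewrite transfE.
have rk_ba : (rank (b * a)%g < rank a)%N.
  apply: proper_card; apply/properP; split.
    apply/subsetP=> _ /imsetP[x _ ->]; rewrite tmulE bE.
    by case: ifP => // _; apply: imset_f.
  exists j => //; apply/negP=> /imsetP[x _]; rewrite tmulE bE.
  by case: ifP => [_ /eqP|/eqP n1 n2]; [rewrite eq_sym (negPf ij)|case: n1].
have bt (Z : {set 'I_n}) : i \notin Z -> {in Z, b =1 t}.
  move=> iZ x xZ; rewrite bE transfE; case: tpermP => [xi|->|_ /eqP/negPf->] //.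
  - by case/negP: iZ; rewrite -xi.
  - by rewrite eqxx.
have bY : {in Y, b =1 id}.
  by move=> x xY; rewrite bE ifN //; apply: contraNneq jY => <-.
have i_tY : i \notin t @: Y by rewrite mem_tperm_imset tpermL.
have tYY : t @: Y != Y.
  by apply/eqP=> e; move: i_tY; rewrite e iY.
have fixed : b @: Y = Y.
  by rewrite -[RHS]imset_id; apply: eq_in_imset.
have moved : b @: (t @: Y) = Y.
  by rewrite -[RHS](imset_tperm2 i j); apply: eq_in_imset; apply: bt.
have := min _ rk_ba Y; rewrite componentM (bigD1 Y) ?fixed //=.
rewrite (bigD1 (t @: Y)) ?moved ?eqxx //= big1 => [|Z /andP[/andP[/eqP bZ ZY] ZtY]].
  rewrite addr0 (supported_id (@component_supported _ _) bY).
  rewrite (@component_supported a _ b t (bt _ i_tY)).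
  move/eqP; rewrite addr_eq0 => /eqP ->; rewrite linearN /= -tactM transf_perm_mul.
  congr (- _); rewrite -[RHS]tact1; congr (tact S _ _).
  by apply: transfP => x; rewrite transfE tperm2 perm1 tone.
(* A contributing [Z] has as many points as [Y], so [b] is injective on it. Then [Z] is [Y] or its
   transpose, according to whether it contains [j]. *)
apply/eqP; apply: contraNT ZtY => nz; have cardZ : #|Z| = apex S.
  by have [|//] := @component_neq0 a Z; apply: contraNneq nz => ->; rewrite linear0.
case: (boolP (j \in Z)) => jZ; last first.
  case/eqP: ZY; rewrite -bZ -[LHS]imset_id; apply: eq_in_imset => x xZ.
  by rewrite bE ifN //; apply: contraNneq jZ => <-.
have bI : {in Z &, injective b} by apply/imset_injP; rewrite bZ cardY cardZ.
have iZ : i \notin Z.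
  apply/negP=> iZ; apply: (elimN eqP ij); apply: bI => //.
  by rewrite !bE eqxx (negPf ij).
have bZt : b @: Z = t @: Z by apply: eq_in_imset; apply: bt.
by rewrite -bZ bZt imset_tperm2.
Qed.

(** For [a] of minimal rank with a nonzero component, exchanges with a spare point of the image of
    [a] show that this component is a sign vector. *)
Lemma component_sign a Y : component a Y != 0 -> sign_type S.
Proof.
move=> aY; pose P f := [exists Z, component f Z != 0].
have Pa : P a by apply/existsP; exists Y.
case: (@arg_minnP _ a P (@rank n) Pa) => {Y aY Pa}a /existsP[Z aZ] min0.
have min b : (rank (b * a)%g < rank a)%N -> forall Y, component (b * a)%g Y = 0.
  move=> lt Y; apply/eqP/negPn/negP => nz; move: lt; rewrite ltnNge min0 //.
  by apply/existsP; exists Y.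
have [cardZ Za] := component_neq0 aZ.
(* If [Z] were the whole image, its component would be the only one left in a sum equal to 0. *)
have [j ja jZ] : exists2 j, j \in a @: [set: 'I_n] & j \notin Z.
  apply/subsetPn/negP=> aZ'; have eqZ : a @: [set: 'I_n] = Z.
    by apply/eqP; rewrite eqEsubset aZ'.
  case/eqP: aZ; rewrite -[RHS](component_sum a) (bigD1 Z) //= big1 ?addr0 // => Y YZ.
  apply/eqP; apply: contraNT YZ => /component_neq0[cardY].
  by rewrite eqZ => YZ; rewrite eqEcard YZ cardY cardZ /=.
have exch := component_exchange min.
exists Z, (component a Z); split=> //; first exact: component_supported.
move=> i i' iZ i'Z ii'.
have ia : i \in a @: [set: 'I_n] by apply: (subsetP Za).
have i'a : i' \in a @: [set: 'I_n] by apply: (subsetP Za).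
have ij : i != j by apply: contraNneq jZ => <-.
have i'j : i' != j by apply: contraNneq jZ => <-.
pose t1 := tperm i j; pose t2 := tperm i' i; pose t3 := tperm j i'.
pose Z1 := transf t1 @: Z; pose Z2 := transf t2 @: Z1.
(* Three exchanges through the spare point [j] return to [Z]; each contributes a factor -1. *)
have tE : transf (tperm i i') = (transf t3 * (transf t2 * transf t1))%g.
  apply: transfP => x; rewrite !tmulE !transfE /t1 /t2 /t3.
  case: (tpermP i j) => [->|->|/eqP xi /eqP xj].
  - by rewrite tpermL (tpermD (x := i') (y := i)) // ?tpermL // eq_sym.
  - by rewrite tpermR (tpermD (x := i) (y := i')) ?tpermR.
  case: (tpermP i' i) => [->|/eqP|/eqP xi' _]; last 2 first.
  - by rewrite (negPf xi).
  - by rewrite !tpermD // eq_sym.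
  by rewrite tpermR tpermD // eq_sym.
have ti : tperm i' i j = j by rewrite tpermD // eq_sym.
have Z3 : transf t3 @: Z2 = Z.
  rewrite /Z2 /Z1 -!imset_tmul -tE; apply/setP=> x; rewrite mem_tperm_imset.
  by case: tpermP => [->|->|]; rewrite ?iZ ?i'Z.
rewrite tE !tactM exch // linearN /= exch ?card_tperm //.
- rewrite !linearN /= opprK exch ?card_tperm ?Z3 //.
  + by rewrite mem_tperm_imset ti mem_tperm_imset tpermR.
  + by rewrite mem_tperm_imset tpermL mem_tperm_imset tpermL.
- by rewrite mem_tperm_imset tpermD // eq_sym.
- by rewrite mem_tperm_imset tpermL.
Qed.

End Components.
End StandardModules.

(** * Arrows out of modules not of sign type *)

Section Extensions.
Variables (n : nat) (F : fieldType).
Hypothesis charF : [pchar F] =i pred0.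
Local Notation A := (monoid_algebra F (full_transf n)).
Implicit Types (S T : fdModule A) (f g h k : full_transf n) (X Y Z : {set 'I_n}).

Lemma linear_malgE (V : vectType F) (phi : {linear A -> V}) (x : A) :
  phi x = \sum_k malg_coef x k *: phi (delta F k).
Proof.
rewrite [in LHS](malg_sum x) linear_sum; apply: eq_bigr => k _; exact: linearZ.
Qed.

(** The first three properties are those of the averaged lift [p0] of [m], passed on because [phi]
    kills the annihilator of [p0]. *)
Lemma ext1_cocycle S T X (m : S) :
  is_simple S -> m != 0 -> (0 < #|X|)%N -> supported X m -> (0 < ext1_dim S T)%N ->
  exists phi : {linear A -> T},
  [/\ forall g h, {in X, g =1 h} -> phi (delta F g) = phi (delta F h),
      alternating X m -> forall h i j, i \in X -> j \in X -> i != j ->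
        phi (delta F (h * transf (tperm i j))%g) = - phi (delta F h),
      forall Y (c : full_transf n -> F), #|Y| = #|X| ->
        \sum_(k : full_transf n | k @: X == Y) c k *: tact S k m = 0 ->
        \sum_(k : full_transf n | k @: X == Y) c k *: phi (delta F k) = 0,
      forall g x, fdm_act S x m = 0 -> phi (delta F g * x) = tact T g (phi x) &
      exists2 x, fdm_act S x m = 0 & phi x != 0].
Proof.
move=> simS m0 /card_gt0P[x0 x0X] suppm ext.
have [p0 [pm p0supp p0alt p0Y]] := equivariant_lift charF x0X suppm.
have gen : forall y, exists a, y = fdm_act S a (pres_map S p0).
  by rewrite pm; apply: simple_cyclic.
have [phi [phi0 phiM phiN]] := ext1_gt0_cyclic gen ext.
rewrite pm in phiM phiN.
exists phi; split=> // [g h gh|altm h i j iX jX ij|Y c cardY c0|g x x0m].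
- apply/eqP; rewrite -subr_eq0 -linearB; apply/eqP/phi0.
  by rewrite fdm_actB; apply/eqP; rewrite subr_eq0; apply/eqP/p0supp.
- apply/eqP; rewrite -subr_eq0 opprK -linearD; apply/eqP/phi0.
  rewrite fdm_actD -[fdm_act _ _ p0]/(tact _ _ p0) tactM p0alt //.
  by rewrite linearN addNr.
- transitivity (phi (\sum_(k : full_transf n | k @: X == Y) c k *: delta F k)).
    by rewrite linear_sum; apply: eq_bigr => k _; rewrite linearZ.
  apply: phi0; rewrite -[LHS]/(orbit_map p0 _) linear_sum -[RHS](p0Y Y c) //.
  by apply: eq_bigr => k _; rewrite linearZ.
- exact: phiM.
Qed.

Lemma apex_gt0 S : (0 < n)%N -> (0 < apex S)%N.
Proof.
move=> n_gt0; apply/card_gt0P; exists (apex_transf S (Ordinal n_gt0)).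
exact: imset_f.
Qed.

Lemma ext1_nonsign S T : (0 < n)%N -> is_simple S -> is_simple T ->
  ~ sign_type S -> (0 < ext1_dim S T)%N -> (apex T < apex S)%N.
Proof.
move=> n_gt0 simS simT nsign ext; rewrite ltnNge; apply/negP => le_apex.
have [X [m [cardX m0 suppm]]] := apex_vector simS.
have X_gt0 : (0 < #|X|)%N by rewrite cardX apex_gt0.
have [phi [phi_loc _ phiY phiM [x xm /eqP[]]]] := ext1_cocycle simS m0 X_gt0 suppm ext.
have cm0 : \sum_k malg_coef x k *: tact S k m = 0 by rewrite -fdm_act_tact.
have comp0 Y : component X m (malg_coef x) 1%g Y = 0.
  apply/eqP/negPn/negP => nz; case: nsign.
  exact: (component_sign simS X_gt0 cardX suppm cm0 nz).
rewrite (linear_malgE phi) (partition_big (fun k : full_transf n => k @: X) predT) //=.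
apply: big1 => Y _; have [cardY|cardY] := eqVneq #|Y| #|X|.
  apply: phiY => //; rewrite -[RHS](comp0 Y); apply: eq_big => k; rewrite mul1g //.
apply: big1 => k /eqP kX; have ltY : (#|Y| < apex S)%N.
  by rewrite -cardX ltn_neqAle cardY -kX leq_imset_card.
have km : fdm_act S (delta F k) m = 0.
  by apply: (@supported_low _ _ _ X) => //; rewrite kX.
have [y0 y0X] := card_gt0P X_gt0.
have ky : k y0 \in Y by rewrite -kX imset_f.
(* Since [k] kills [m], the retraction onto [Y] can be pulled out of [phi]; its rank is below the
   apex of [T]. *)
rewrite -(phi_loc (retract Y (k y0) * k)%g k) => [|z zX]; last first.
  by rewrite tmulE retract_id // -kX imset_f.
rewrite -delta_mul phiM // low_rank ?scaler0 //.
by rewrite rank_retract // (leq_trans ltY).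
Qed.

End Extensions.

(** * Alternating functions and simplex boundaries *)

Section Simplices.
Variables (n : nat) (F : fieldType).
Hypothesis charF : [pchar F] =i pred0.
Implicit Types (f g h k : full_transf n) (X Y Z : {set 'I_n}) (i j p q x : 'I_n).

Definition subst p i h : full_transf n := transf (fun x => if x == p then i else h x).

Lemma substE p i h x : subst p i h x = if x == p then i else h x.
Proof. exact: transfE. Qed.

Lemma tmul_subst g p i h : (g * subst p i h)%g = subst p (g i) (g * h)%g.
Proof.
by apply: transfP => x; rewrite tmulE !substE tmulE; case: eqP.
Qed.

Section AlternatingMaps.
Variables (V : lmodType F) (X : {set 'I_n}) (D : full_transf n -> V).
Hypothesis D_loc : forall g h, {in X, g =1 h} -> D g = D h.
Hypothesis D_alt : forall h i j, i \in X -> j \in X -> i != j ->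
  D (h * transf (tperm i j))%g = - D h.

(** Induction on the number of points moved by [s]: following [s] by the transposition of [x] and
    [s x] makes it fix [x]. *)
Lemma alt_perm (s : {perm 'I_n}) h : perm_on X s ->
  D (h * transf s)%g = (-1) ^+ s *: D h.
Proof.
have [k] := ubnP #|[set x | s x != x]|; elim: k s h => // k IHk s h; rewrite ltnS.
have [/eqP s1 _ _|/set0Pn[x]] := boolP ([set x | s x != x] == set0).
  have sE : s = 1%g.
    by apply/permP=> x; move/setP/(_ x): s1; rewrite !inE perm1 => /eqP.
  rewrite sE odd_perm1 scale1r; apply: D_loc => x _.
  by rewrite tmulE transfE perm1.
rewrite inE => sx le_k sX; pose t := tperm x (s x).
have xX : x \in X by apply/negPn/negP => /(out_perm sX)/eqP; rewrite (negPf sx).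
have sxX : s x \in X by rewrite perm_closed.
have tX : perm_on X t.
  by apply: subset_trans (tperm_on _ _) _; apply/subsetP=> z /set2P[]->.
have sE : s = (s * t * t)%g by rewrite -mulgA tperm2 mulg1.
have stX : perm_on X (s * t)%g by apply: perm_onM.
have lt_k : (#|[set y | (s * t)%g y != y]| < k)%N.
  apply: leq_trans le_k; apply: proper_card; apply/properP; split.
    apply/subsetP=> y; rewrite !inE permM; apply: contra => /eqP sy.
    rewrite sy /t; case: tpermP => [yx|ysx|//].
      by case/eqP: sx; rewrite -yx.
    by case/eqP: sx; apply: (@perm_inj _ s); rewrite -ysx.
  by exists x; rewrite !inE // permM tpermR eqxx.
rewrite [in LHS]sE -transf_perm_mul mulgA IHk // D_alt // 1?eq_sym //.
by rewrite odd_permM odd_tperm eq_sym sx signr_addb expr1 mulrN1 scalerN scaleNr opprK.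
Qed.

Lemma alt_ninj h p q : p \in X -> q \in X -> p != q -> h p = h q -> D h = 0.
Proof.
move=> pX qX pq hpq; have e : D h = - D h.
  rewrite -[in RHS](D_alt h pX qX pq); apply: D_loc => x xX.
  by rewrite tmulE transfE; case: tpermP => [->|->|].
apply/eqP; have : D h *+ 2 == 0 by rewrite mulr2n {2}e addrN.
by rewrite -scaler_nat scaler_eq0; move/pcharf0P: charF => ->.
Qed.

(* The alternating form of the boundary of the oriented simplex (i, h), in     *)
(* which h stands for its restriction to X.                                    *)
Definition simplex i h : V := D h - \sum_(p in X) D (subst p i h).

Lemma simplex_loc i h k : {in X, h =1 k} -> simplex i h = simplex i k.
Proof.
move=> hk; rewrite /simplex (D_loc hk); congr (_ - _); apply: eq_bigr => p _.
by apply: D_loc => x xX; rewrite !substE hk.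
Qed.

(** If [i] is [h q], the term at [q] cancels [D h], and every other term takes the value [i]
    twice. *)
Lemma simplex_mem i h : i \in h @: X -> simplex i h = 0.
Proof.
case/imsetP=> q qX ->; rewrite /simplex (bigD1 q) //= big1 => [|p /andP[pX pq]].
  rewrite addr0; apply/eqP; rewrite subr_eq0; apply/eqP/D_loc => x _.
  by rewrite substE; case: eqP => [->|].
by apply: (alt_ninj pX qX pq); rewrite !substE eqxx eq_sym (negPf pq).
Qed.

(** If [h] agrees at [a] and [b], only the terms at [a] and [b] can survive, and they cancel. *)
Lemma simplex_ninj i h : ~ {in X &, injective h} -> simplex i h = 0.
Proof.
move=> ninj; have [a [b [aX bX ab hab]]] :
    exists a b, [/\ a \in X, b \in X, a != b & h a = h b].
  apply: contrapT => none; apply: ninj => a b aX bX hab; apply/eqP/negPn/negP => ab.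
  by apply: none; exists a, b.
rewrite /simplex (alt_ninj aX bX ab hab) (bigD1 a) // (bigD1 b) /=; last first.
  by rewrite bX eq_sym.
rewrite big1 => [|p /andP[/andP[pX pa] pb]]; last first.
  by apply: (alt_ninj aX bX ab); rewrite !substE !ifN // eq_sym.
rewrite -(D_loc (g := subst b i h * transf (tperm a b))%g) => [|x xX].
  by rewrite D_alt // addr0 addNr subr0.
rewrite tmulE transfE !substE.
case: tpermP => [->|->|/eqP/negPf-> /eqP/negPf->]; rewrite ?eqxx //.
by rewrite (negPf ab) eq_sym (negPf ab).
Qed.

(** Swapping [i] with a value [h u] interchanges [D h] and the term at [u]; swapping two values of
    [h] amounts to a transposition of [X]. *)
Lemma simplex_tperm i h a b : {in X &, injective h} -> i \notin h @: X ->
  a \in i |: h @: X -> b \in i |: h @: X -> a != b ->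
  simplex (tperm a b i) (transf (tperm a b) * h)%g = - simplex i h.
Proof.
move=> hI ihX.
have swap u : u \in X ->
    simplex (tperm i (h u) i) (transf (tperm i (h u)) * h)%g = - simplex i h.
  move=> uX; rewrite tpermL.
  have hE x : x \in X -> tfun (transf (tperm i (h u)) * h)%g x = subst u i h x.
    move=> xX; rewrite tmulE transfE substE.
    case: eqP => [->|xu]; first by rewrite tpermR.
    rewrite tpermD //; first by apply: contraNneq ihX => ->; apply: imset_f.
    by apply/eqP=> /hI e; apply: xu; rewrite e.
  rewrite (simplex_loc _ hE) /simplex (bigD1 u) //= [in RHS](bigD1 u) //=.
  have -> : D (subst u (h u) (subst u i h)) = D h.
    by apply: D_loc => x _; rewrite !substE; case: eqP => [->|].
  rewrite (eq_bigr (fun p => - D (subst p i h))) => [|p /andP[pX pu]].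
    by rewrite sumrN !opprB addrA.
  rewrite -(D_alt _ pX uX pu); apply: D_loc => x xX; rewrite tmulE transfE !substE.
  case: tpermP => [->|->|/eqP/negPf-> /eqP/negPf-> //]; rewrite ?eqxx //.
    by rewrite eq_sym (negPf pu).
  by rewrite eq_sym (negPf pu).
case/setU1P=> [->|/imsetP[u uX ->]]; case/setU1P=> [->|/imsetP[v vX ->]].
- by rewrite eqxx.
- by move=> _; apply: swap.
- by move=> _; rewrite tpermC; apply: swap.
move=> huv; have uv : u != v by apply: contraNneq huv => ->.
rewrite tpermD; last 2 first.
- by apply: contraNneq ihX => <-; apply: imset_f.
- by apply: contraNneq ihX => <-; apply: imset_f.
have hE x : x \in X -> tfun (transf (tperm (h u) (h v)) * h)%g x
    = tfun (h * transf (tperm u v))%g x.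
  move=> xX; rewrite !tmulE !transfE; case: (tpermP u v x) => [->|->|xu xv].
  - by rewrite tpermL.
  - by rewrite tpermR.
  by rewrite tpermD //; apply/eqP=> /hI e; [apply: xu|apply: xv]; rewrite e.
rewrite (simplex_loc _ hE) /simplex D_alt // opprD opprK; congr (_ + _).
rewrite (reindex_inj (@perm_inj _ (tperm u v))) /= -sumrN.
have uvX : perm_on X (tperm u v).
  by apply: subset_trans (tperm_on u v) _; apply/subsetP=> z /set2P[]->.
apply: eq_big => [p|p pX]; first by rewrite perm_closed.
rewrite -[RHS]opprK -(D_alt (subst p i h) uX vX uv); congr (- _); apply: D_loc => x xX.
rewrite tmulE transfE !substE tmulE transfE.
by rewrite (can2_eq (tpermK u v) (tpermK u v)).
Qed.

End AlternatingMaps.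
End Simplices.

(** * Arrows out of modules of sign type *)

Section SignType.
Variables (n : nat) (F : fieldType).
Hypothesis charF : [pchar F] =i pred0.
Local Notation A := (monoid_algebra F (full_transf n)).
Implicit Types (S T : fdModule A) (f g h k : full_transf n) (X Y Z : {set 'I_n}).
Implicit Types (i j p q x : 'I_n).

Lemma back_neq X p g y :
  back X p g y != p -> back X p g y \in X /\ g (back X p g y) = y.
Proof. by rewrite transfE; case: pickP => [x /andP[xX /eqP]|_] //=; rewrite eqxx. Qed.

Lemma back_in X p g y : p \in X -> back (X :\ p) p g y \in X.
Proof.
by move=> pX; rewrite transfE; case: pickP => [x /andP[/setD1P[_ xX] _]|].
Qed.

Lemma back_default X p g y : y \notin g @: X -> back X p g y = p.
Proof.
move=> yX; rewrite transfE; case: pickP => [x /andP[xX /eqP gx]|] //.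
by case/negP: yX; rewrite -gx imset_f.
Qed.

Definition fixes_after f X (s : {perm 'I_n}) : bool := [forall x in X, f (s x) == x].

(* If f maps X to itself, this is its sign on X, or 0 if f is not injective on X. *)
Definition sgn_on X f : F := \sum_(s in Sym X | fixes_after f X s) (-1) ^+ s.

Lemma fixes_after_inj f X (s : {perm 'I_n}) :
  perm_on X s -> fixes_after f X s -> {in X &, injective f}.
Proof.
move=> sX /forall_inP fs x y xX yX; have sVX : perm_on X s^-1%g by apply: perm_onV.
rewrite -(permKV s x) -(permKV s y) (eqP (fs _ _)) ?perm_closed //.
by rewrite (eqP (fs _ _)) ?perm_closed // => ->.
Qed.

Lemma sgn_onE S X (m : S) f : supported X m -> alternating X m ->
  {in X, forall x, f x \in X} -> tact S f m = sgn_on X f *: m.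
Proof.
move=> suppm altm fX; pose E h := tact S h m.
have E_loc g h : {in X, g =1 h} -> E g = E h by apply: suppm.
have E_alt h i j : i \in X -> j \in X -> i != j ->
    E (h * transf (tperm i j))%g = - E h.
  by move=> iX jX ij; rewrite /E tactM altm // linearN.
have [fI|ninj] := pselect {in X &, injective f}; last first.
  rewrite /sgn_on big_pred0 => [|s]; last first.
    by apply/negP=> /andP[]; rewrite inE => sX /(fixes_after_inj sX).
  rewrite scale0r -[LHS]/(E f); apply: contrapT => nz; apply: ninj => a b aX bX fab.
  apply: contrapT => /eqP ab; apply: nz.
  exact: (alt_ninj charF E_loc E_alt aX bX ab fab).
have [t tX tE] := extend_injection fI fX.
rewrite (suppm f (1 * transf t)%g) => [|x xX]; last by rewrite mul1g transfE tE.
rewrite -[LHS]/(E _) (alt_perm E_loc E_alt) // /E tact1; congr (_ *: m).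
have tVX : perm_on X t^-1%g by apply: perm_onV.
rewrite /sgn_on (big_pred1 t^-1%g) ?odd_permV // => s /=; rewrite inE.
apply/andP/eqP => [[sX /forall_inP fs]|->].
  apply/permP=> x; have [xX|xX] := boolP (x \in X); last by rewrite !(@out_perm _ X).
  by apply: (@perm_inj _ t); rewrite permKV tE ?perm_closed // (eqP (fs x xX)).
split=> //; apply/forall_inP=> x xX.
by rewrite -tE ?perm_closed // permKV.
Qed.

(* Up to the factor |X|!, the sum of the D (subst p i h) is a fixed linear     *)
(* function of h m: it is read off the coefficients on m of the vectors a h m, *)
(* where a inverts some g on X minus a point p and maps the rest to p.         *)
Lemma subst_relation S X (m : S) (V : lmodType F) (D : full_transf n -> V) i
    (c : full_transf n -> F) :
  m != 0 -> supported X m -> alternating X m ->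
  (forall g h, {in X, g =1 h} -> D g = D h) ->
  (forall h i j, i \in X -> j \in X -> i != j ->
    D (h * transf (tperm i j))%g = - D h) ->
  \sum_h c h *: tact S h m = 0 ->
  \sum_h c h *: (\sum_(p in X) D (subst p i h)) = 0.
Proof.
move=> m0 suppm altm D_loc D_alt cm0.
pose a p g := back (X :\ p) p g.
have coef0 p g : p \in X -> \sum_h c h * sgn_on X (a p g * h)%g = 0.
  move=> pX; apply/eqP; have : (\sum_h c h * sgn_on X (a p g * h)%g) *: m == 0.
    apply/eqP; transitivity (tact S (a p g) (\sum_h c h *: tact S h m)).
      rewrite linear_sum scaler_suml; apply: eq_bigr => h _ /=.
      rewrite tactZ -tactM (sgn_onE suppm altm) ?scalerA // => x xX.
      by rewrite tmulE back_in.
    by rewrite cm0 linear0.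
  by rewrite scaler_eq0 (negPf m0) orbF.
(* Pinning [g] to [i] off [X :\ p] leaves one [g] for each map on [X :\ p]. *)
pose G p g := [forall x, (x \notin X :\ p) ==> (g x == i)].
have : \sum_(p in X) \sum_(g | G p g) (\sum_h c h * sgn_on X (a p g * h)%g) *: D g = 0.
  by rewrite big1 // => p pX; rewrite big1 // => g _; rewrite coef0 // scale0r.
have inner h : \sum_(p in X) \sum_(g | G p g) sgn_on X (a p g * h)%g *: D g =
    (#|X|`!)%:R *: \sum_(p in X) D (subst p i h).
  have [hI|ninj] := pselect {in X &, injective h}; last first.
    have -> : \sum_(p in X) D (subst p i h) = 0.
      have := simplex_ninj charF D_loc D_alt i ninj.
      rewrite /simplex => /eqP; rewrite subr_eq0 => /eqP <-.
      apply: contrapT => nz; apply: ninj => u v uX vX huv.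
      apply: contrapT => /eqP uv; apply: nz.
      exact: (alt_ninj charF D_loc D_alt uX vX uv huv).
    rewrite scaler0 big1 // => p pX; rewrite big1 // => g _.
    rewrite /sgn_on big_pred0 ?scale0r // => s; apply/negP=> /andP[].
    rewrite inE => sX /(fixes_after_inj sX) ahI; apply: ninj => u v uX vX huv.
    by apply: ahI => //; rewrite !tmulE huv.
  (* For injective [h], each pair [s], [p] admits exactly one [g], namely [h] after [s] on [X :\ p].
     The signs cancel, so each [s] contributes the full sum of the [D (subst p i h)]. *)
  transitivity (\sum_(s in Sym X) \sum_(p in X)
      \sum_(g | G p g && fixes_after (a p g * h)%g X s) (-1) ^+ s *: D g).
    rewrite exchange_big /=; apply: eq_bigr => p pX.
    rewrite (exchange_big_dep (G p)) /=; last by move=> s g _ /andP[].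
    apply: eq_bigr => g Gg; rewrite /sgn_on scaler_suml; apply: eq_bigl => s.
    by rewrite Gg.
  rewrite -card_Sym -sumr_const scaler_suml; apply: eq_bigr => s.
  rewrite inE scale1r => sX.
  rewrite [RHS](reindex_inj (@perm_inj _ s)) /=.
  apply: eq_big => [p|p pX]; first by rewrite perm_closed.
  pose g0 := transf (fun x => if x \in X :\ p then h (s x) else i).
  have hsI : {in X &, injective (fun x => h (s x))}.
    move=> x y xX yX hxy; apply: (@perm_inj _ s).
    by apply: hI; rewrite ?perm_closed.
  have g0E x : x \in X :\ p -> g0 x = h (s x) by rewrite transfE => ->.
  rewrite (big_pred1 g0) => [|g /=].
    rewrite (D_loc g0 (subst (s p) i h * transf s)%g) => [|x xX].
      by rewrite (alt_perm D_loc D_alt) // scalerA -signr_addb addbb scale1r.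
    rewrite tmulE substE [transf s x]transfE (inj_eq perm_inj) transfE.
    by rewrite in_setD1 xX andbT; case: eqP.
  apply/andP/eqP => [[/forallP Gg /forall_inP fx]|->].
    apply: transfP => x; rewrite transfE; case: ifPn => xX; last first.
      by move: (Gg x); rewrite xX => /eqP.
    have /setD1P[xp xX'] := xX.
    have := fx x xX'; rewrite tmulE => /eqP e.
    by have := @back_neq (X :\ p) p g (h (s x)); rewrite -/(a p g) e => /(_ xp)[].
  split.
    by apply/forallP=> x; apply/implyP=> xX; rewrite transfE (negPf xX).
  apply/forall_inP=> x xX; rewrite tmulE; have [->|xp] := eqVneq x p.
    rewrite /a back_default //; apply/imsetP=> -[q qX]; rewrite g0E // => /hsI.
    by case/setD1P: qX => qp qX /(_ pX qX) /esym/eqP; rewrite (negPf qp).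
  have xXp : x \in X :\ p by rewrite in_setD1 xp.
  rewrite -g0E // /a backK // => u v uX vX; rewrite !g0E // => /hsI.
  by case/setD1P: uX => _ uX; case/setD1P: vX => _ vX; apply.
move=> total; have : (#|X|`!)%:R *: \sum_h c h *: (\sum_(p in X) D (subst p i h)) = 0.
  rewrite -[RHS]total scaler_sumr.
  under [RHS]eq_bigr => p _ do under eq_bigr => g _ do rewrite scaler_suml.
  under [RHS]eq_bigr => p _ do rewrite exchange_big /=.
  rewrite [RHS]exchange_big /=; apply: eq_bigr => h _.
  rewrite scalerA mulrC -scalerA -inner scaler_sumr; apply: eq_bigr => p _.
  by rewrite scaler_sumr; apply: eq_bigr => g _; rewrite scalerA.
move/eqP; rewrite scaler_eq0; case/orP=> [|/eqP//].
by move/pcharf0P: charF => ->; rewrite eqn0Ngt fact_gt0.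
Qed.

Lemma ext1_sign S T : (0 < n)%N -> is_simple S -> is_simple T ->
  sign_type S -> (0 < ext1_dim S T)%N -> sign_type T /\ apex T = (apex S).+1.
Proof.
move=> n_gt0 simS simT [X [m [cardX m0 suppm altm]]] ext.
have X_gt0 : (0 < #|X|)%N by rewrite cardX apex_gt0.
have [x0 x0X] := card_gt0P X_gt0.
have [phi [D_loc /(_ altm) D_alt _ phiM [x xm phix]]] :=
  ext1_cocycle charF simS m0 X_gt0 suppm ext.
pose D h := phi (delta F h); pose E h := tact S h m.
have E_loc g h : {in X, g =1 h} -> E g = E h by apply: suppm.
have E_alt h i j : i \in X -> j \in X -> i != j ->
    E (h * transf (tperm i j))%g = - E h.
  by move=> iX jX ij; rewrite /E tactM altm // linearN.
have cm0 : \sum_k malg_coef x k *: tact S k m = 0 by rewrite -fdm_act_tact.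
(* By [subst_relation] the sums of substituted terms cancel over the relation [x], so [phi x] is a
   combination of simplices with extra vertex [x0]. *)
have [h Dh] : exists h, simplex X D x0 h != 0.
  apply: contrapT => none; case/eqP: phix; rewrite (linear_malgE phi).
  rewrite -[RHS](subst_relation x0 m0 suppm altm D_loc D_alt cm0).
  apply: eq_bigr => k _; congr (_ *: _); apply/eqP; rewrite -subr_eq0.
  by apply/negPn/negP => nz; apply: none; exists k.
have hI : {in X &, injective h}.
  apply: contrapT => ninj; case/eqP: Dh.
  exact: (simplex_ninj charF D_loc D_alt).
have x0h : x0 \notin h @: X.
  by apply: contra Dh => hx0; rewrite (simplex_mem charF D_loc D_alt).
pose z i k : A := simplex X (@delta F _) i k.
have zM g i k : delta F g * z i k = z (g i) (g * k)%g.
  rewrite /z /simplex mulrBr delta_mul mulr_sumr; congr (_ - _).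
  by apply: eq_bigr => p _; rewrite delta_mul tmul_subst.
have phi_z i k : phi (z i k) = simplex X D i k by rewrite linearB linear_sum.
have zE i k : fdm_act S (z i k) m = simplex X E i k.
  by rewrite -[LHS]/(orbit_map m _) linearB linear_sum.
(* Retracting onto [X] forces the r + 1 vertices into a set of r points, where every boundary is
   degenerate. *)
have zm : fdm_act S (z x0 h) m = 0.
  apply: (simple_killed (e := retract X x0) simS (_ : tact S _ m != 0)) => [|g].
    by rewrite (supported_id suppm) //; apply: retract_id.
  rewrite /tact -fdm_actE zM zE.
  set k : full_transf n := (_ * h)%g.
  have kX y : y \in X -> k y \in X by rewrite /k -mulgA tmulE retract_in.
  have [kI|ninj] := pselect {in X &, injective k}; last first.
    exact: (simplex_ninj charF E_loc E_alt).
  apply: (simplex_mem charF E_loc E_alt).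
  suff -> : k @: X = X by rewrite tmulE retract_in.
  apply/eqP; rewrite eqEcard card_in_imset // leqnn andbT.
  by apply/subsetP=> _ /imsetP[y yX ->]; apply: kX.
pose v := simplex X D x0 h; pose Y := x0 |: h @: X.
have vM g : tact T g v = simplex X D (g x0) (g * h)%g.
  by rewrite /v -phi_z -phiM // zM phi_z.
have cardY : #|Y| = (apex S).+1 by rewrite cardsU1 x0h card_in_imset // cardX.
have suppv : supported Y v.
  move=> g g' gg; rewrite !vM gg ?setU11 //; apply: (simplex_loc D_loc) => y yX.
  by rewrite !tmulE gg // setU1r // imset_f.
have low g : (rank g < (apex S).+1)%N -> tact T g v = 0.
  rewrite ltnNge => /negP rk; rewrite vM; apply: contrapT => nz; apply: rk.
  have ghI : {in X &, injective (tfun (g * h)%g)}.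
    by apply: contrapT => ninj; apply: nz; apply: (simplex_ninj charF D_loc D_alt).
  have gx0 : g x0 \notin tfun (g * h)%g @: X.
    by apply/negP=> mem; apply: nz; apply: (simplex_mem charF D_loc D_alt).
  rewrite -cardX -(card_in_imset ghI).
  apply: leq_trans (_ : #|g x0 |: tfun (g * h)%g @: X| <= _)%N.
    by rewrite cardsU1 gx0.
  apply: subset_leq_card; apply/subsetP=> _ /setU1P[->|/imsetP[y _ ->]].
    exact: imset_f.
  by rewrite tmulE imset_f.
(* As [v] generates [T], a rank bound that kills [v] kills all of [T]. *)
have apexT : apex T = (apex S).+1.
  apply: (apexE (v := v) (g := retract Y x0) simT).
  - by rewrite (supported_id suppv) //; apply: retract_id.
  - by rewrite rank_retract ?setU11.
  move=> g u rk; have [b ->] := simple_cyclic simT Dh u.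
  rewrite fdm_act_tact linear_sum big1 // => k _.
  rewrite linearZ /= -tactM low ?scaler0 //.
  exact: leq_ltn_trans (rank_mulr g k) rk.
split=> //; exists Y, v; split=> //; first by rewrite apexT.
move=> i j iY jY ij; rewrite vM transfE.
exact: (simplex_tperm D_loc D_alt).
Qed.

(** * The height function and acyclicity *)

Definition vertex_height S : nat :=
  if `[< sign_type S >] then (n - apex S)%N else (n + apex S)%N.

Lemma ext1_height S T : (0 < n)%N -> is_simple S -> is_simple T ->
  (0 < ext1_dim S T)%N -> (vertex_height T < vertex_height S)%N.
Proof.
move=> n_gt0 simS simT ext.
(* This bound keeps the truncated subtraction strictly decreasing when the apex grows by one. *)
have le_n (U : fdModule A) : (apex U <= n)%N by apply: rank_le.
rewrite {2}/vertex_height; case: asboolP => [signS|nsign].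
  have [signT apexT] := ext1_sign n_gt0 simS simT signS ext.
  rewrite /vertex_height asboolT // apexT ltn_sub2l // -apexT; exact: le_n.
have lt := ext1_nonsign charF n_gt0 simS simT nsign ext.
apply: (@leq_ltn_trans (n + apex T)%N); last by rewrite ltn_add2l.
rewrite /vertex_height; case: ifP => // _.
exact: leq_trans (leq_subr _ _) (leq_addr _ _).
Qed.

Lemma quiver_acyclic : (0 < n)%N -> acyclic (algebra_quiver A).
Proof.
move=> n_gt0 [k [v [k_gt0 vk arr]]].
pose ht (i : nat) := vertex_height (class_repr (v i)).
have step (i : nat) : (i < k)%N -> (ht i.+1 < ht i)%N.
  by move=> lt; apply: ext1_height (arr i lt) => //; apply: (class_reprP _).1.
have le1 (i : nat) : (0 < i)%N -> (i <= k)%N -> (ht i < ht 0)%N.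
  elim: i => // -[|i] IHi _ le_ik; first exact: step.
  by apply: ltn_trans (step _ le_ik) (IHi _ _) => //; apply: ltnW.
by have := le1 k k_gt0 (leqnn k); rewrite /ht vk ltnn.
Qed.

End SignType.

Theorem corollary3p8 (R : realType) (n : nat) (hn : (1 <= n)%N) :
  acyclic (algebra_quiver (monoid_algebra (complex R) (full_transf n))).
Proof. exact: quiver_acyclic (Num.Theory.pchar_num _) hn. Qed.
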